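(* The pointwise topology is the unique Polish semigroup topology on $\mathcal{M}_{\mathbb{Q}}$. That is, the pointwise topology $\mathcal{T}_{pw}$ is a Polish semigroup topology on $\mathcal{M}_{\mathbb{Q}}$, and every Polish semigroup topology $\mathcal{T}$ on $\mathcal{M}_{\mathbb{Q}}$ satisfies $\mathcal{T}=\mathcal{T}_{pw}$.
   Context: $\mathcal{M}_{\mathbb{Q}}$ is the monoid, under composition of functions, of all (not necessarily strictly) increasing maps $f\colon\mathbb{Q}\to\mathbb{Q}$ with respect to the usual order (so $x\le y$ implies $f(x)\le f(y)$). The pointwise topology $\mathcal{T}_{pw}$ on $\mathcal{M}_{\mathbb{Q}}$ is the subspace topology inherited from the product topology on $\mathbb{Q}^{\mathbb{Q}}$, where each copy of $\mathbb{Q}$ is discrete; it is generated by the sets $\{s\in\mathcal{M}_{\mathbb{Q}} : s(x)=y\}$, $x,y\in\mathbb{Q}$. A topology on $\mathcal{M}_{\mathbb{Q}}$ is a semigroup topology if composition $\mathcal{M}_{\mathbb{Q}}\times\mathcal{M}_{\mathbb{Q}}\to\mathcal{M}_{\mathbb{Q}}$ is continuous (with the product topology on the left). Polish means second countable and completely metrisable. *)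

(* Defs.v *)
From HB Require Import structures.
From mathcomp Require Import all_boot all_order all_algebra.
From mathcomp Require Import all_classical all_reals all_analysis.

Set Implicit Arguments.
Unset Strict Implicit.
Unset Printing Implicit Defensive.

Import Order.TTheory GRing.Theory Num.Theory.

Local Open Scope classical_set_scope.
Local Open Scope ring_scope.

(* Topologies on a type X are quantified over as classes tau : Topological X,
   with Topological.Pack tau the corresponding topological space.  Such a
   class also carries irrelevant eqType and choiceType structures on X, so
   two topologies are the same when they have the same open sets. *)
Definition same_topology (X : Type) (tau1 tau2 : Topological X) : Prop :=
  @open (Topological.Pack tau1) = @open (Topological.Pack tau2) :> set (set X).

(* Completeness is that of completeType, which is not used here because it
   also requires the space to be pointed. *)
Definition completely_metrizable (R : realType) (X : Type)
    (tau : Topological X) : Prop :=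
  exists2 m : Metric R X,
    same_topology (Topological.class (Metric.Pack m)) tau &
    forall F : set_system (Metric.Pack m),
      ProperFilter F -> cauchy F -> exists x : Metric.Pack m, F --> x.

Definition polish (R : realType) (X : Type) (tau : Topological X) : Prop :=
  @second_countable (Topological.Pack tau) /\ completely_metrizable R tau.

Definition semigroup_topology (X : Type) (op : X -> X -> X)
    (tau : Topological X) : Prop :=
  let S := Topological.Pack tau in
  continuous (fun p : S * S => op p.1 p.2 : S).

(* rat is wrapped in discrete_topology because its structure of numFieldType
   may also give it the order topology. *)
Definition increasing_maps : set {ptws rat -> discrete_topology rat} :=
  [set f | {homo (f : rat -> rat) : x y / x <= y}].

Definition MQ : Type := set_type increasing_maps.

(* The topology of set_type is the subspace topology, and that of
   {ptws _ -> _} is the product topology. *)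
HB.instance Definition _ := Topological.copy MQ (set_type increasing_maps).

Definition pointwise_topology : Topological MQ := Topological.class MQ.

Definition MQ_fun (f : MQ) : rat -> rat := set_val f.

Lemma MQ_comp_subproof (f g : MQ) : increasing_maps (MQ_fun f \o MQ_fun g).
Proof.
by move=> x y xy; apply: (set_valP f); apply: (set_valP g).
Qed.

Definition MQ_comp (f g : MQ) : MQ := SigSub (mem_set (MQ_comp_subproof f g)).

(* Main.v *)
Require Import Defs.
From HB Require Import structures.
From mathcomp Require Import all_boot all_order all_algebra.
From mathcomp Require Import all_classical all_reals all_analysis.
From mathcomp Require Import lra.

Set Implicit Arguments.
Unset Strict Implicit.
Unset Printing Implicit Defensive.

Import Order.TTheory GRing.Theory Num.Theory.

Local Open Scope classical_set_scope.
Local Open Scope ring_scope.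

(** Let [T] be a Polish semigroup topology on the monoid of increasing maps;
it has to be compared with the pointwise topology, which is itself Polish (its
ultrametric measures how long two maps agree along an enumeration of the
rationals) and compatible with composition.

The topology [T] is finer than the pointwise one ([open_eval]). The constant
maps form a [T]-closed set, which is countable; by Baire's theorem one of them
is isolated in it, and by homogeneity all of them are. As composing [s] with
the constant map [x] gives the constant map [s x], the condition [s x = y] is
[T]-open.

Conversely, call a map generic when it is surjective and all its fibres are
open intervals. Three facts show that [T] is not strictly finer.

First, the stabiliser of a finite set [F] in the automorphism group of the
rationals acts transitively on the generic maps with prescribed values on [F]
([generic_transitive]): this is Cantor's back-and-forth argument.

Second, generic maps are [T]-dense ([generic_dense]). By Baire's theorem it
suffices that no nonempty [T]-open set [V] misses a single requirement of
genericity, such as taking the value [y] somewhere to the left of a given cut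
of the domain. Given [t] in [V], there are maps [f r] and [g r], for all real
numbers [r <= 1], such that [f r \o g r = t] whereas
[f r \o g s] takes the value [y] where it should for all [r < s] ([fill_left]).
As [T] is second countable and there are uncountably many indices, some [g s]
belongs to a neighbourhood of [g r], with [r < s], that [f r] maps into [V]:
hence [V] contains a map [f r \o g s].

Third, on the automorphism group both topologies agree near the identity
([aut_open_mapping]): a pair of mutually inverse maps can be seen as a point of
a Polish group, whose topology is finer than the pointwise one, so that this is
an instance of the open mapping theorem.

Now let [W] be a [T]-neighbourhood of [f] ([open_pointwise]). By the third fact
and the continuity of composition, there are a smaller neighbourhood [A] of [f]
and a finite set [F] such that [d \o c] stays in [W] if [d] is in [A] and [c] is
an automorphism fixing [F]. By density, [A] contains a generic [d] agreeing with
[f] on [F]; by transitivity every generic map that agrees with [f] on [F] is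
such a [d \o c], thus belongs to [W]. By density again, all maps that agree with
[f] on [F] are in the closure of [W]. As [T] is regular, it is the pointwise
topology. *)

(** * Fair constructions in countably many steps *)

(** Dependent choice with a list of requirements: step [n] of the construction
takes care of the [n]-th one. *)
Lemma fair_chain (T : Type) (P : T -> Prop) (le : T -> T -> Prop)
    (Q : nat -> T -> Prop) (x0 : T) :
  P x0 ->
  (forall n x, P x -> exists y, [/\ P y, le x y & Q n y]) ->
  exists u : nat -> T,
    u 0%N = x0 /\ forall n, [/\ P (u n), le (u n) (u n.+1) & Q n (u n.+1)].
Proof.
move=> Px0 step.
pose S (p q : {x : T | P x} * nat) :=
  [/\ q.2 = p.2.+1, le (sval p.1) (sval q.1) & Q p.2 (sval q.1)].
have stepS p : {q | S p q}.
  apply: cid; case: p => -[x Px] n.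
  by have [y [Py xy Qy]] := step n x Px; exists (exist _ y Py, n.+1).
have [f [f0 fS]] := dependent_choice stepS (exist _ x0 Px0, 0%N).
have f2 n : (f n).2 = n.
  by elim: n => [|n ih]; rewrite ?f0 //; case: (fS n) => ->; rewrite ih.
exists (fun n => sval (f n).1); split=> [|n]; first by rewrite f0.
by have [_ le_n] := fS n; rewrite f2; split=> //; case: (f n).1.
Qed.

Lemma chain_trans (T : Type) (le : T -> T -> Prop) (u : nat -> T) :
  (forall x, le x x) -> (forall x y z, le x y -> le y z -> le x z) ->
  (forall n, le (u n) (u n.+1)) ->
  forall m n, (m <= n)%N -> le (u m) (u n).
Proof.
move=> refl trans step m n /subnK <-; elim: (n - m)%N => [|k ih] //.
exact: trans ih (step _).
Qed.

(** * Back and forth *)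

(** What makes back and forth work, both for the plain order of an interval
(constant [u]) and for a map with its fibres ([A] full): the colour classes of
[u] are intervals of [A] without end points, lined up in the order of their
colours. *)
Record open_fibres (A : set rat) (u : rat -> rat) : Prop := OpenFibres {
  fibres_mono : forall a b, A a -> A b -> a <= b -> u a <= u b;
  fibres_convex : forall a b c, A a -> A c -> a < b -> b < c -> A b;
  fibres_nomax : forall a, A a -> exists b, [/\ A b, a < b & u b = u a];
  fibres_nomin : forall a, A a -> exists b, [/\ A b, b < a & u b = u a] }.

Section Interpolation.
Context (A : set rat) (u : rat -> rat) (Au : open_fibres A u).

Let fibre_above (b0 : rat) (l : seq rat) : A b0 ->
  (forall x, x \in l -> A x /\ u x <= u b0) ->
  exists b, [/\ A b, u b = u b0 & forall x, x \in l -> x < b].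
Proof.
move=> Ab0; elim: l => [|x l ih] ll; first by exists b0.
have [|b [Ab ub lb]] := ih; first by move=> z zl; apply: ll; rewrite inE zl orbT.
have [Ax ux] := ll x (mem_head _ _).
have [xb|bx] := ltP x b.
  by exists b; split=> // z; rewrite inE => /predU1P[->//|/lb].
have uxE : u x = u b0.
  by apply/eqP; rewrite eq_le ux -ub (fibres_mono Au).
have [c [Ac xc uc]] := fibres_nomax Au Ax.
exists c; split=> //; first by rewrite uc.
move=> z; rewrite inE => /predU1P[->//|/lb zb].
exact: lt_trans zb (le_lt_trans bx xc).
Qed.

Let fibre_between (b0 : rat) (l : seq rat) : A b0 ->
  (forall x, x \in l -> A x /\ x < b0) ->
  exists b, [/\ A b, u b = u b0, b < b0 & forall x, x \in l -> x < b].
Proof.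
move=> Ab0; elim: l => [|x l ih] ll.
  by have [b [Ab bb0 ub]] := fibres_nomin Au Ab0; exists b.
have [|b [Ab ub bb0 lb]] := ih.
  by move=> z zl; apply: ll; rewrite inE zl orbT.
have [Ax xb0] := ll x (mem_head _ _).
have [xb|bx] := ltP x b.
  by exists b; split=> // z; rewrite inE => /predU1P[->//|/lb].
have [xm mb0] := midf_lt xb0.
have bm := le_lt_trans bx xm.
have Am := fibres_convex Au Ab Ab0 bm mb0.
exists ((x + b0) / 2); split=> //.
  apply/eqP; rewrite eq_le (fibres_mono Au) ?(ltW mb0) //= -ub.
  by rewrite (fibres_mono Au) ?(ltW bm).
move=> z; rewrite inE => /predU1P[->//|/lb zb].
exact: lt_trans zb bm.
Qed.

(** The extension step: the colour of [b0] occurs strictly between the finite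
sets [l] and [h] as soon as monotonicity does not forbid it. *)
Lemma interpolate (b0 : rat) (l h : seq rat) : A b0 ->
  (forall x, x \in l -> A x /\ u x <= u b0) ->
  (forall x, x \in h -> A x /\ u b0 <= u x) ->
  (forall x y, x \in l -> y \in h -> x < y) ->
  exists b, [/\ A b, u b = u b0, forall x, x \in l -> x < b
    & forall x, x \in h -> b < x].
Proof.
move=> Ab0 ll; elim: h => [|y h ih] hh lh.
  by have [b [? ? ?]] := fibre_above Ab0 ll; exists b.
have [z zh|x z xl zh|b [Ab ub lb hb]] := ih.
- by apply: hh; rewrite inE zh orbT.
- by apply: lh => //; rewrite inE zh orbT.
have [Ay uy] := hh y (mem_head _ _).
have [lt_by|le_yb] := ltP b y.
  by exists b; split=> // z; rewrite inE => /predU1P[->//|/hb].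
have uyE : u y = u b0.
  by apply/eqP; rewrite eq_le uy -ub (fibres_mono Au).
have [x xl|c [Ac uc cy lc]] := @fibre_between y l Ay.
  by split; [case: (ll x xl) | apply: lh; rewrite ?mem_head].
exists c; split=> //; first by rewrite uc.
move=> z; rewrite inE => /predU1P[->//|/hb].
exact: lt_trans (lt_le_trans cy le_yb).
Qed.

End Interpolation.

(** Order isomorphisms are built as relations, which dispenses with choosing
values outside of [A] and [B]. *)
Definition order_rel (R : rat -> rat -> Prop) : Prop :=
  forall a b a' b', R a b -> R a' b' -> (a <= a') = (b <= b').

Section BackAndForth.

Definition partial_iso (A B : set rat) (u v : rat -> rat)
    (p : seq (rat * rat)) : Prop :=
  order_rel (fun a b => (a, b) \in p) /\
  forall a b, (a, b) \in p -> [/\ A a, B b & u a = v b].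

Let swap (p : seq (rat * rat)) := [seq (ab.2, ab.1) | ab <- p].

Let mem_swap p a b : ((a, b) \in swap p) = ((b, a) \in p).
Proof.
apply/mapP/idP => [[[x y] xyp [-> ->]] //|bap].
by exists (b, a).
Qed.

Let partial_iso_swap A B u v p :
  partial_iso A B u v p -> partial_iso B A v u (swap p).
Proof.
move=> [pP pAB]; split=> [a b a' b'|a b]; rewrite !mem_swap.
  by move=> pb pb'; rewrite (pP _ _ _ _ pb pb').
by case/pAB.
Qed.

Let forth A B u v p a : open_fibres A u -> open_fibres B v ->
  (forall a, A a -> exists2 b, B b & v b = u a) ->
  partial_iso A B u v p -> A a ->
  exists b, partial_iso A B u v ((a, b) :: p).
Proof.
move=> Au Bv uv [pP pAB] Aa.
(* A point that is already matched keeps its partner. *)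
have [[b abp]|nap] := pselect (exists b, (a, b) \in p).
  exists b; have memE x : (x \in (a, b) :: p) = (x \in p).
    by rewrite inE; case: eqP => // ->; rewrite abp.
  by split=> [x y x' y'|x y]; rewrite !memE; [apply: pP|apply: pAB].
have [b0 Bb0 ub0] := uv _ Aa.
pose l := [seq ab.2 | ab <- p & ab.1 < a].
pose h := [seq ab.2 | ab <- p & a < ab.1].
have lP y : reflect (exists2 x, (x, y) \in p & x < a) (y \in l).
  apply: (iffP mapP) => [[[x z]]|[x xyp xa]].
    by rewrite mem_filter /= => /andP[xa xzp] ->; exists x.
  by exists (x, y) => //; rewrite mem_filter xa.
have hP y : reflect (exists2 x, (x, y) \in p & a < x) (y \in h).
  apply: (iffP mapP) => [[[x z]]|[x xyp xa]].
    by rewrite mem_filter /= => /andP[xa xzp] ->; exists x.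
  by exists (x, y) => //; rewrite mem_filter xa.
have [y /lP[x /pAB[Ax By <-]] xa|y /hP[x /pAB[Ax By <-]] xa|y z|b [Bb vb lb hb]]
    := @interpolate B v Bv b0 l h Bb0.
- by split=> //; rewrite ub0 (fibres_mono Au) ?ltW.
- by split=> //; rewrite ub0 (fibres_mono Au) ?ltW.
- move=> /lP[x xyp xa] /hP[x' xzp' xa'].
  by rewrite ltNge -(pP _ _ _ _ xzp' xyp) -ltNge (lt_trans xa).
exists b.
have cmp x y : (x, y) \in p -> (a <= x) = (b <= y) /\ (x <= a) = (y <= b).
  move=> xyp; case: (ltgtP a x) => [ax|xa|eq_ax].
  - have lt_by : b < y by apply: hb; apply/hP; exists x.
    by rewrite (ltW lt_by) leNgt lt_by.
  - have lt_yb : y < b by apply: lb; apply/lP; exists x.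
    by rewrite (ltW lt_yb) leNgt lt_yb.
  - by case: nap; exists y; rewrite eq_ax.
split=> [x y x' y'|x y]; rewrite !inE.
  move=> /predU1P[[-> ->]|xyp] /predU1P[[-> ->]|xyp']; rewrite ?lexx //.
  - by case: (cmp _ _ xyp').
  - by case: (cmp _ _ xyp).
  - exact: pP.
by move=> /predU1P[[-> ->]|/pAB//]; split=> //; rewrite vb.
Qed.

(** Cantor's theorem, for coloured orders and with a prescribed finite set
[F] of fixed points. *)
Lemma back_and_forth (A B : set rat) (u v : rat -> rat) (F : seq rat) :
  open_fibres A u -> open_fibres B v ->
  (forall a, A a -> exists2 b, B b & v b = u a) ->
  (forall b, B b -> exists2 a, A a & u a = v b) ->
  (forall x, x \in F -> [/\ A x, B x & u x = v x]) ->
  exists R : rat -> rat -> Prop,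
    [/\ order_rel R, forall a b, R a b -> [/\ A a, B b & u a = v b],
        forall a, A a -> exists b, R a b, forall b, B b -> exists a, R a b
      & forall x, x \in F -> R x x].
Proof.
move=> Au Bv uv vu FAB.
pose le (p q : seq (rat * rat)) := {subset p <= q}.
pose Q n (p : seq (rat * rat)) := forall x, unpickle n = Some x ->
  (A x -> exists y, (x, y) \in p) /\ (B x -> exists y, (y, x) \in p).
pose p0 := [seq (x, x) | x <- F].
have p0P a b : (a, b) \in p0 -> a = b /\ a \in F by case/mapP=> x xF [-> ->].
have [| |w [w0 wP]] := @fair_chain _ (partial_iso A B u v) le Q p0.
- split=> [a b a' b' /p0P[<- _] /p0P[<- _] //|a b /p0P[<-]]; exact: FAB.
- move=> n p isop.
  case nx : (unpickle n : option rat) => [x|]; last first.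
    by exists p; split=> // x; rewrite nx.
  have [q [isoq pq qx]] : exists q, [/\ partial_iso A B u v q, le p q
      & A x -> exists y, (x, y) \in q].
    have [Ax|nAx] := pselect (A x); last by exists p; split=> // z.
    have [y isoy] := forth Au Bv uv isop Ax.
    exists ((x, y) :: p); split=> // [ab abp|_]; first by rewrite inE abp orbT.
    by exists y; rewrite mem_head.
  have [Bx|nBx] := pselect (B x); last first.
    by exists q; split=> // z; rewrite nx => -[<-].
  have [y /partial_iso_swap isoy] := forth Bv Au vu (partial_iso_swap isoq) Bx.
  have swapK : swap (swap q) = q.
    by rewrite /swap -map_comp map_id_in // => -[].
  rewrite /= swapK in isoy.
  exists ((y, x) :: q); split=> // [ab /pq abq|z].
    by rewrite inE abq orbT.
  rewrite nx => -[<-]; split=> [/qx[t tq]|_].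
    by exists t; rewrite inE tq orbT.
  by exists y; rewrite mem_head.
have w_mono : forall m n, (m <= n)%N -> le (w m) (w n).
  apply: chain_trans => [p x //|p q r pq qr x /pq/qr //|n]; by case: (wP n).
exists (fun a b => exists n, (a, b) \in w n); split.
- move=> a b a' b' [m ab] [n ab'].
  have [[+ _] _ _] := wP (maxn m n); apply.
    exact: w_mono (leq_maxl _ _) _ ab.
  exact: w_mono (leq_maxr _ _) _ ab'.
- by move=> a b [n]; have [[_ +] _ _] := wP n; apply.
- move=> a Aa; have [_ _ /(_ a (pickleK a))[/(_ Aa)[b ab] _]] := wP (pickle a).
  by exists b, (pickle a).+1.
- move=> b Bb; have [_ _ /(_ b (pickleK b))[_ /(_ Bb)[a ab]]] := wP (pickle b).
  by exists a, (pickle b).+1.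
- by move=> x xF; exists 0%N; rewrite w0; apply/mapP; exists x.
Qed.

End BackAndForth.

(** * Increasing maps and automorphisms of the rationals *)

Local Coercion MQ_fun : MQ >-> Funclass.

Lemma MQ_mono (f : MQ) (x y : rat) : x <= y -> f x <= f y.
Proof. exact: (set_valP f). Qed.

Lemma MQ_ext (f g : MQ) : MQ_fun f =1 MQ_fun g -> f = g.
Proof. by move=> fg; apply: val_inj; apply/funext. Qed.

Definition mkMQ (f : rat -> rat) (fP : {homo f : x y / x <= y}) : MQ :=
  SigSub (mem_set (fP : increasing_maps f)).

Lemma mkMQE f fP x : @mkMQ f fP x = f x. Proof. by []. Qed.

Lemma MQ_compE (f g : MQ) x : MQ_comp f g x = f (g x). Proof. by []. Qed.

Definition MQ_id : MQ := mkMQ (fun x y (xy : x <= y) => xy).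

Definition MQ_const (c : rat) : MQ := mkMQ (fun _ _ _ => lexx c).

Definition MQ_shift (c : rat) : MQ := mkMQ (fun x y xy => lerD xy (lexx c)).

Lemma MQ_oppP (f : MQ) : {homo (fun x => - f (- x)) : x y / x <= y}.
Proof. by move=> x y xy; rewrite lerN2 MQ_mono ?lerN2. Qed.

(** Conjugation by the order reversing map [x |-> - x]: an involutive
automorphism of the monoid that exchanges left and right. *)
Definition MQ_opp (f : MQ) : MQ := mkMQ (MQ_oppP f).

Lemma MQ_oppM (f g : MQ) :
  MQ_opp (MQ_comp f g) = MQ_comp (MQ_opp f) (MQ_opp g).
Proof. by apply: MQ_ext => x; rewrite !(mkMQE, MQ_compE) opprK. Qed.

Lemma MQ_oppK (f : MQ) : MQ_opp (MQ_opp f) = f.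
Proof. by apply: MQ_ext => x; rewrite !mkMQE !opprK. Qed.

Definition agree (F : seq rat) (f g : MQ) : Prop := {in F, f =1 g}.

Lemma agree_refl F f : agree F f f. Proof. by []. Qed.

Lemma agree_sym F f g : agree F f g -> agree F g f.
Proof. by move=> fg x xF; rewrite fg. Qed.

Lemma agree_trans F f g h : agree F f g -> agree F g h -> agree F f h.
Proof. by move=> fg gh x xF; rewrite fg ?gh. Qed.

Lemma agree_sub F E f g : {subset E <= F} -> agree F f g -> agree E f g.
Proof. by move=> EF fg x /EF/fg. Qed.

Record autQ := AutQ {
  aut_map :> MQ;
  aut_inv : MQ;
  autK : cancel aut_map aut_inv;
  autVK : cancel aut_inv aut_map }.

Definition aut1 : autQ := @AutQ MQ_id MQ_id (fun=> erefl) (fun=> erefl).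

Definition autV (g : autQ) : autQ := AutQ (autVK g) (autK g).

Definition autM (g h : autQ) : autQ.
Proof.
apply: (@AutQ (MQ_comp g h) (MQ_comp (aut_inv h) (aut_inv g))) => x.
  by rewrite !MQ_compE !autK.
by rewrite !MQ_compE !autVK.
Defined.

Lemma aut_of_rel (R : rat -> rat -> Prop) :
  order_rel R -> (forall a, exists b, R a b) -> (forall b, exists a, R a b) ->
  exists g : autQ, forall a b, R a b -> g a = b.
Proof.
move=> Ro /choice[f Rf] /choice[h Rh].
have fE a b : R a b -> f a = b.
  move=> ab; apply/le_anti.
  by rewrite -!(Ro _ _ _ _ ab (Rf a), Ro _ _ _ _ (Rf a) ab) lexx.
have hE a b : R a b -> h b = a.
  move=> ab; apply/le_anti.
  by rewrite !(Ro _ _ _ _ ab (Rh b), Ro _ _ _ _ (Rh b) ab) lexx.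
have fP : {homo f : x y / x <= y}.
  by move=> x y; rewrite (Ro _ _ _ _ (Rf x) (Rf y)).
have hP : {homo h : x y / x <= y}.
  by move=> x y; rewrite -(Ro _ _ _ _ (Rh x) (Rh y)).
have fK : cancel (mkMQ fP) (mkMQ hP) by move=> x; exact: hE.
have hK : cancel (mkMQ hP) (mkMQ fP) by move=> x; exact: fE.
by exists (AutQ fK hK) => a b /fE.
Qed.

Lemma aut_le (g : autQ) (x y : rat) : (g x <= g y) = (x <= y).
Proof.
apply/idP/idP; last exact: MQ_mono.
by move/(MQ_mono (aut_inv g)); rewrite !autK.
Qed.

(** * Generic maps *)

(** Surjective maps whose fibres are open intervals: up to automorphisms there
is just one of them, the projection of the lexicographic product of two copies
of the rationals onto its first factor. *)
Definition generic (d : MQ) : Prop :=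
  forall q, [/\ exists x, d x = q, exists2 x, q < x & d x = d q
    & exists2 x, x < q & d x = d q].

Lemma generic_open_fibres (d : MQ) : generic d -> open_fibres setT d.
Proof.
move=> dg; split=> // [a b _ _|a _|a _]; first exact: MQ_mono.
  by have [_ [b ab db] _] := dg a; exists b.
by have [_ _ [b ab db]] := dg a; exists b.
Qed.

Lemma generic_transitive (d d' : MQ) (F : seq rat) :
  generic d -> generic d' -> agree F d d' ->
  exists2 c : autQ, agree F c MQ_id & d' = MQ_comp d c.
Proof.
move=> dg dg' dd'.
have [a _|b _|x xF|R [Ro RE RA RB RF]] := @back_and_forth setT setT d' d F
    (generic_open_fibres dg') (generic_open_fibres dg).
- by have [[b db] _ _] := dg (d' a); exists b.
- by have [[a da] _ _] := dg' (d b); exists a.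
- by rewrite dd'.
have [||c cP] := aut_of_rel Ro; [by move=> a; apply: RA|by move=> b; apply: RB|].
exists c => [x /RF/cP //|]; apply: MQ_ext => x.
have [y xy] := RA x I; have [_ _ ->] := RE _ _ xy.
by rewrite MQ_compE (cP _ _ xy).
Qed.

(** * Two families of increasing maps indexed by the reals *)

Section Fill.
Context (R : realType).

Let ratr_ltr (r s : R) : r < s -> exists q : rat, r < ratr q < s.
Proof.
by move=> rs; have [q] := rat_in_itvoo rs; rewrite in_itv /=; exists q.
Qed.

(** Both [L] and the rationals below [r] are countable dense orders without
end points. *)
Let squeeze (L : set rat) (r : R) :
  L !=set0 -> (forall x y, L y -> x <= y -> L x) ->
  (forall x, L x -> exists2 y, L y & x < y) ->
  exists S : rat -> rat -> Prop,
    [/\ order_rel S, forall a b, S a b -> L a /\ ratr b < r,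
      forall a, L a -> exists b, S a b
    & forall b, ratr b < r -> exists a, S a b].
Proof.
move=> [l Ll] Ldown Lnomax.
have fibL : open_fibres L (fun=> 0).
  split=> // [a b c _ Lc _ bc|a La|a La]; first exact: Ldown Lc (ltW bc).
    by have [b Lb ab] := Lnomax a La; exists b.
  by exists (a - 1); split=> //; [apply: Ldown La _|]; lra.
pose B : set rat := [set b | ratr b < r].
have fibB : open_fibres B (fun=> 0).
  split=> // [a b c _ Bc _ bc|a Ba|a Ba].
  - by apply: lt_trans Bc; rewrite ltr_rat.
  - by have [q /andP[aq qr]] := ratr_ltr Ba; exists q; rewrite -(ltr_rat R).
  - exists (a - 1); split=> //; last by lra.
    by apply: lt_trans Ba; rewrite ltr_rat; lra.
have [q /andP[_ qr]] : exists q : rat, r - 1 < ratr q < r.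
  by apply: ratr_ltr; rewrite ltrBlDr ltrDl.
have [a _|b _|x|S [So SE SA SB _]] := @back_and_forth L B _ _ [::] fibL fibB => //.
- by exists q.
- by exists l.
by exists S; split=> // a b /SE[].
Qed.

(** The factorisation [t = f r \o g r] leaves between [r] and [1] a gap in the
image of [g r], on which [f r] takes the value [y]; for [s > r] the map [g s]
reaches into that gap from the left. *)
Lemma fill_left (t : MQ) (L : set rat) (y : rat) :
  L !=set0 -> (forall x y, L y -> x <= y -> L x) ->
  (forall x, L x -> exists2 y, L y & x < y) ->
  (forall x, L x -> t x <= y) -> (forall x, ~ L x -> y <= t x) ->
  exists f g : R -> MQ,
    (forall r, r <= 1 -> MQ_comp (f r) (g r) = t) /\
    (forall r s, r < s -> s <= 1 ->
       exists2 x, L x & MQ_comp (f r) (g s) x = y).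
Proof.
move=> L0 Ldown Lnomax tL tU; have [l Ll] := L0.
have [S SP] := choice (fun r => squeeze r L0 Ldown Lnomax).
have So r : order_rel (S r) by case: (SP r).
have SE r a b : S r a b -> L a /\ ratr b < r by case: (SP r) => _ + _ _; apply.
have [phi phiP] : exists phi : R -> rat -> rat, forall r a, L a -> S r a (phi r a).
  have /choice[phi phiP] : forall ra : R * rat, exists b, L ra.2 -> S ra.1 ra.2 b.
    move=> [r a]; have [La|] := pselect (L a); last by exists 0.
    by have [_ _ /(_ a La)[b Sab] _] := SP r; exists b.
  by exists (fun r a => phi (r, a)) => r a; apply: (phiP (r, a)).
have [psi psiP] : exists psi : R -> rat -> rat,
    forall r b, ratr b < r -> S r (psi r b) b.
  have /choice[psi psiP] : forall rb : R * rat,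
      exists a, ratr rb.2 < rb.1 -> S rb.1 a rb.2.
    move=> [r b]; have [rb|] := pselect (ratr b < r); last by exists 0.
    by have [_ _ _ /(_ b rb)[a Sab]] := SP r; exists a.
  by exists (fun r b => psi (r, b)) => r b; apply: (psiP (r, b)).
have up x z : ~ L x -> x <= z -> ~ L z.
  by move=> nLx xz Lz; apply: nLx; apply: Ldown Lz xz.
(* Above [L], the translation by [1 - l] leads beyond [1], out of the way of
   the isomorphisms [S r] for all [r <= 1]. *)
pose g0 r x := if pselect (L x) then phi r x else x - l + 1.
pose f0 r q := if pselect (ratr q < r) then t (psi r q) else
  if pselect (L (q - 1 + l)) then y else t (q - 1 + l).
have rat_lt1 (q : rat) : ((ratr q : R) < 1) = (q < 1).
  by rewrite -(ltr_rat R) rmorph1.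
have f0P r : {homo f0 r : p q / p <= q}.
  move=> p q pq; rewrite /f0.
  have pq' : p - 1 + l <= q - 1 + l by lra.
  case: (pselect (_ p < r)) => [pr|npr]; case: (pselect (_ q < r)) => [qr|nqr] /=.
  - by rewrite MQ_mono // (So _ _ _ _ _ (psiP _ _ pr) (psiP _ _ qr)).
  - have [Lpsi _] := SE _ _ _ (psiP _ _ pr).
    case: (pselect (L (q - 1 + l))) => [_|nL] /=; first exact: tL.
    exact: le_trans (tL _ Lpsi) (tU _ nL).
  - by case: npr; apply: le_lt_trans qr; rewrite ler_rat.
  - case: (pselect (L (p - 1 + l))) => [Lp|nLp];
      case: (pselect (L (q - 1 + l))) => [Lq|nLq] //=.
    + exact: tU.
    + by case: (up _ _ nLp pq').
    + exact: MQ_mono.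
(* [g0 r] is increasing for [r <= 1] only, hence the minimum. *)
have g0P r : {homo g0 (Num.min r 1) : p q / p <= q}.
  move=> p q pq; rewrite /g0.
  case: (pselect (L p)) => [Lp|nLp]; case: (pselect (L q)) => [Lq|nLq] /=.
  - by rewrite -(So _ _ _ _ _ (phiP _ _ Lp) (phiP _ _ Lq)).
  - have [_] := SE _ _ _ (phiP (Num.min r 1) _ Lp).
    rewrite lt_min rat_lt1 => /andP[_].
    have lq : l < q by rewrite ltNge; apply/negP => /(Ldown _ _ Ll).
    lra.
  - by case: (up _ _ nLp pq).
  - by lra.
exists (fun r => mkMQ (f0P r)), (fun r => mkMQ (g0P r)); split=> [r r1|r s rs s1].
  apply: MQ_ext => x; rewrite MQ_compE !mkMQE /g0 /f0.
  rewrite (min_idPl r1).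
  case: (pselect (L x)) => [Lx|nLx] /=.
    have Sx := phiP r x Lx; have [_ lt_r] := SE _ _ _ Sx.
    case: (pselect (_ < r)) => // _ /=; congr (MQ_fun t _).
    have Spsi := psiP _ _ lt_r; apply/le_anti.
    by rewrite !(So _ _ _ _ _ Sx Spsi, So _ _ _ _ _ Spsi Sx) lexx.
  have lx : l < x by rewrite ltNge; apply/negP => /(Ldown _ _ Ll).
  case: (pselect (_ < r)) => [lt_r|_] /=.
    have := lt_le_trans lt_r r1; rewrite rat_lt1 .
    by have /lt_trans/[apply] : 1 < x - l + 1 by lra; rewrite ltxx.
  have -> : x - l + 1 - 1 + l = x by lra.
  by case: (pselect (L x)).
have [q /andP[rq qs]] := ratr_ltr rs.
have Sq := psiP s q qs; have [Lx _] := SE _ _ _ Sq.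
exists (psi s q) => //; rewrite MQ_compE !mkMQE /g0 /f0 (min_idPl s1).
case: (pselect (L (psi s q))) => // Lx' /=.
have -> : phi s (psi s q) = q.
  have Sx := phiP s _ Lx; apply/le_anti.
  by rewrite -!(So _ _ _ _ _ Sx Sq, So _ _ _ _ _ Sq Sx) lexx.
case: (pselect (_ < r)) => [/lt_trans/(_ rq)|_] /=; first by rewrite ltxx.
have q1 : q < 1 by rewrite -rat_lt1 (lt_le_trans qs).
by case: (pselect (L _)) => // -[]; apply: Ldown Ll _; lra.
Qed.

Lemma fill_right (t : MQ) (U : set rat) (y : rat) :
  U !=set0 -> (forall x y, U x -> x <= y -> U y) ->
  (forall x, U x -> exists2 y, U y & y < x) ->
  (forall x, U x -> y <= t x) -> (forall x, ~ U x -> t x <= y) ->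
  exists f g : R -> MQ,
    (forall r, r <= 1 -> MQ_comp (f r) (g r) = t) /\
    (forall r s, r < s -> s <= 1 ->
       exists2 x, U x & MQ_comp (f r) (g s) x = y).
Proof.
move=> [l Ul] Uup Unomin tU tL.
(* Conjugate by [x |-> - x]. *)
have [||x Ux|x Ux|x nUx|f [g [fgt fgy]]] :=
    @fill_left (MQ_opp t) [set x | U (- x)] (- y).
- by exists (- l); rewrite /= opprK.
- by move=> x z /= Uz xz; apply: Uup Uz _; rewrite lerN2.
- by have [z Uz zx] := Unomin _ Ux; exists (- z) => /=; rewrite ?opprK // ltrNr.
- by rewrite lerN2; apply: tU.
- by rewrite lerN2; apply: tL.
exists (fun r => MQ_opp (f r)), (fun r => MQ_opp (g r)); split=> [r r1|r s rs s1].
  by rewrite -MQ_oppM fgt ?MQ_oppK.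
have [x Ux xy] := fgy r s rs s1; exists (- x) => //.
by rewrite -MQ_oppM mkMQE opprK xy opprK.
Qed.

End Fill.

(** * The pointwise topology *)

Lemma nbhs_agree (f : MQ) (F : seq rat) : nbhs f [set g | agree F g f].
Proof.
elim: F => [|x F ih]; first by apply: filterS filterT => g _ x.
have ev : {for f, continuous (fun g : MQ => MQ_fun g x : discrete_topology rat)}.
  apply: (@continuous_comp _ {ptws rat -> discrete_topology rat} _
    (set_val : MQ -> _) (fun h => h x)); first exact: initial_continuous.
  exact: proj_continuous.
have := ev _ (discrete_set1 _); move: ih; apply: filterS2 => g gf gx y.
by rewrite inE => /predU1P[->|/gf].
Qed.

Lemma pointwise_nbhsP (f : MQ) (W : set MQ) :
  nbhs f W <-> exists F, [set g | agree F g f] `<=` W.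
Proof.
split=> [[_ [[V oV <-] Vf VW]]|[F FW]]; last exact: filterS FW (nbhs_agree f F).
(* The traces of the sets [agree F] generate a filter converging to [f]. *)
pose cyl (F : seq rat) : set {ptws rat -> discrete_topology rat} :=
  [set h : rat -> rat | forall x, x \in F -> h x = f x].
have cylF : Filter (filter_from setT cyl).
  apply: filter_from_filter; first by exists [::].
  move=> F E _ _; exists (F ++ E) => // h hf.
  by split=> x xF; apply: hf; rewrite mem_cat xF ?orbT.
have cvg_f : filter_from setT cyl --> (MQ_fun f : {ptws rat -> discrete_topology rat}).
  apply/cvg_sup => x D [_ [[B _ <-] Bfx BD]].
  exists [:: x] => // h hf; apply: BD; rewrite /= /proj.
  by rewrite hf ?mem_head.
have [|F _ FV] := cvg_f V; first exact: open_nbhs_nbhs.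
by exists F => g gf; apply: VW; apply: FV => x /gf.
Qed.

Lemma pointwise_openP (U : set MQ) :
  open U <-> forall f, U f -> exists F, [set g | agree F g f] `<=` U.
Proof.
rewrite openE; split=> [UU f /UU /pointwise_nbhsP //|UU f /UU ?].
exact/pointwise_nbhsP.
Qed.

Lemma pointwise_semigroup : semigroup_topology MQ_comp pointwise_topology.
Proof.
move=> [f g] W /pointwise_nbhsP[F FW].
exists ([set f' | agree (map (MQ_fun g) F) f' f], [set g' | agree F g' g]).
  by split; apply: nbhs_agree.
move=> [f' g'] /= [ff gg]; apply: FW => x xF.
by rewrite !MQ_compE gg // ff ?map_f.
Qed.

Lemma pointwise_second_countable :
  @second_countable (Topological.Pack pointwise_topology).
Proof.
pose cyl (p : seq (rat * rat)) : set MQ :=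
  [set f | forall ab, ab \in p -> f ab.1 = ab.2].
exists (range cyl).
  exact: sub_countable (card_image_le _ _) (countableP _).
split=> [_ [p _ <-]|f W /pointwise_nbhsP[F FW]].
  apply/pointwise_openP => f fp; exists (map fst p) => g gf ab abp.
  by rewrite gf ?fp ?map_f.
exists (cyl [seq (x, MQ_fun f x) | x <- F]) => [|g gf]; last first.
  by apply: FW => x xF; rewrite (gf (x, MQ_fun f x)) // map_f.
by split; [exists [seq (x, MQ_fun f x) | x <- F] | move=> ab /mapP[x _ ->]].
Qed.

Section PointwiseMetric.
Context (R : realType).

Let differ (f g : MQ) (n : nat) : bool :=
  `[< exists2 x : rat, pickle x = n & f x <> g x >].

Let differ_ex (f g : MQ) : f <> g -> exists n, differ f g n.
Proof.
move=> fg; apply/not_existsP => same; apply: fg; apply: MQ_ext => x.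
by apply: contrapT => fgx; apply: (same (pickle x)); apply/asboolP; exists x.
Qed.

Let dist (f g : MQ) : R :=
  if pselect (f = g) is right fg then (ex_minn (differ_ex fg)).+1%:R^-1 else 0.

Let dist_lt (f g : MQ) (n : nat) :
  dist f g < n.+1%:R^-1 <-> forall x : rat, (pickle x <= n)%N -> f x = g x.
Proof.
rewrite /dist; case: pselect => [<-|fg]; first by rewrite invr_gt0 ltr0n.
case: ex_minnP => m /asboolP[z zm fgz] min_m.
rewrite ltf_pV2 ?posrE ?ltr0n // ltr_nat ltnS; split=> [nm x xn|agr].
  apply: contrapT => fgx; have := min_m (pickle x).
  move=> /(_ (asboolT (ex_intro2 _ _ x erefl fgx))) mx.
  by have := leq_trans mx xn; rewrite leqNgt nm.
by rewrite ltnNge; apply/negP => mn; apply: fgz; apply: agr; rewrite zm.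
Qed.

Let dist_ge (f g : MQ) (z : rat) :
  f z <> g z -> (pickle z).+1%:R^-1 <= dist f g.
Proof. by move=> fgz; rewrite leNgt; apply/negP => /dist_lt/(_ z (leqnn _)). Qed.

Let dist_attained (f g : MQ) :
  f = g \/ exists2 z, f z <> g z & dist f g = (pickle z).+1%:R^-1.
Proof.
rewrite /dist; case: pselect => [|fg]; [by left|right].
by case: ex_minnP => m /asboolP[z <- fgz] _; exists z.
Qed.

Let distxx (f : MQ) : dist f f = 0.
Proof. by rewrite /dist; case: pselect. Qed.

Let dist_ge0 (f g : MQ) : 0 <= dist f g.
Proof. by rewrite /dist; case: pselect => // fg; rewrite invr_ge0 ler0n. Qed.

Let dist_pos (f g : MQ) : dist f g = 0 -> f = g.
Proof.
by rewrite /dist; case: pselect => // fg /eqP; rewrite invr_eq0 pnatr_eq0.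
Qed.

Let dist_sym (f g : MQ) : dist f g = dist g f.
Proof.
have le f' g' : dist f' g' <= dist g' f'.
  have [->//|[z fgz ->]] := dist_attained f' g'.
  by apply: dist_ge => /esym.
by apply/le_anti; rewrite !le.
Qed.

Let dist_triangle (g f h : MQ) : dist f h <= dist f g + dist g h.
Proof.
have [->|[z fhz ->]] := dist_attained f h; first by rewrite distxx addr_ge0 ?dist_ge0.
have [fgz|fgz] := pselect (f z = g z).
  by rewrite ler_wpDl ?dist_ge0 // dist_ge // -fgz.
by rewrite ler_wpDr ?dist_ge0 // dist_ge.
Qed.

(** An ultrametric: the distance of two maps tells how long they agree along
an enumeration of the rationals. *)
Definition pw_metric : Type := MQ.

HB.instance Definition _ := Choice.copy pw_metric MQ.
HB.instance Definition _ :=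
  isMetric.Build R pw_metric distxx dist_pos dist_sym dist_triangle.

Let ball_agree (f : pw_metric) (n : nat) :
  ball f (n.+1%:R^-1 : R) =
  [set g : MQ | forall x : rat, (pickle x <= n)%N -> (f : MQ) x = g x].
Proof.
by rewrite ballEmdist; apply/seteqP; split=> g /= /dist_lt.
Qed.

Let inv_succ_lt (e : R) : 0 < e -> exists n, n.+1%:R^-1 < e.
Proof.
move=> e0; have [n _ /(_ n (leqnn n)) ne] := near_infty_natSinv_lt (PosNum e0).
by exists n.
Qed.

Lemma pw_metric_topology :
  same_topology (Topological.class pw_metric) pointwise_topology.
Proof.
apply/seteqP; split=> [U|U /pointwise_openP UP].
  rewrite /= openE => UU; apply/pointwise_openP => f /UU /nbhs_ballP[e /= e0 eU].
  have [n ne] := inv_succ_lt e0.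
  exists (pmap unpickle (iota 0 n.+1)) => g gf; apply: eU.
  apply: le_ball (ltW ne) _ _; rewrite ball_agree => x xn.
  rewrite gf // mem_pmap; apply/mapP; exists (pickle x); rewrite ?pickleK //.
  by rewrite mem_iota ltnS.
rewrite openE => f /UP[F FU]; apply/nbhs_ballP.
exists ((\max_(x <- F) pickle x).+1%:R^-1) => /=.
  by rewrite invr_gt0 ltr0n.
move=> g; rewrite ball_agree => fg; apply: FU => x xF.
by rewrite fg // leq_bigmax_seq.
Qed.

Lemma pointwise_completely_metrizable :
  completely_metrizable R pointwise_topology.
Proof.
exists (Metric.class pw_metric); first exact: pw_metric_topology.
move=> F PF /cauchyP cF.
(* [u n] decides the limit at the rationals of rank at most [n]. *)
have /choice[u uP] n : exists f : pw_metric, F (ball f (n.+1%:R^-1 : R)).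
  by apply: cF; rewrite invr_gt0 ltr0n.
have uu (x : rat) n : (pickle x <= n)%N -> (u n : MQ) x = (u (pickle x) : MQ) x.
  move=> xn; have [h] := filter_ex (filterI (uP n) (uP (pickle x))).
  by rewrite !ball_agree => -[-> // ->].
have limP : {homo (fun x : rat => (u (pickle x) : MQ) x) : x y / x <= y}.
  move=> x y xy; set n := maxn (pickle x) (pickle y).
  by rewrite -!(uu _ n) ?leq_maxl ?leq_maxr // MQ_mono.
exists (mkMQ limP : pw_metric) => W /nbhs_ballP[e /= e0 eW].
have [n ne] := inv_succ_lt e0.
apply: filterS (uP n) => g; rewrite ball_agree => ug; apply: eW.
apply: le_ball (ltW ne) _ _; rewrite ball_agree => x xn.
by rewrite -ug // uu.
Qed.

End PointwiseMetric.

(** * The automorphism group *)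

(** Density in a basic open set of the pointwise topology, the one given by
[h] and [F]. *)
Definition dense_at (A : set autQ) (h : autQ) (F : seq rat) : Prop :=
  forall (k : autQ) (E : seq rat), agree F k h ->
  exists2 x : autQ, agree E x k & A x.

Lemma dense_at_sub (A : set autQ) (h k : autQ) (F E : seq rat) :
  agree F k h -> {subset F <= E} -> dense_at A h F -> dense_at A k E.
Proof.
move=> kh FE Ah l D lk; apply: Ah.
exact: agree_trans (agree_sub FE lk) kh.
Qed.

Lemma dense_at_agree (A : set autQ) (h x : autQ) (F E : seq rat) :
  dense_at A h F -> (forall y : autQ, A y -> agree E y x) -> agree E h x.
Proof.
move=> Ah Ax; have [y yh Ay] := Ah h E (agree_refl _).
exact: agree_trans (agree_sym yh) (Ax y Ay).
Qed.

(** Baire's theorem for the automorphism group with the pointwise topology.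
Each step also decides one value of the limit and one of its inverse. *)
Lemma baire_aut (A : nat -> set autQ) :
  (forall g, exists n, A n g) -> exists n h F, dense_at (A n) h F.
Proof.
move=> Acover; apply: contrapT => nodense.
have sparse n (h : autQ) F : exists (k : autQ) E,
    agree F k h /\ forall x : autQ, agree E x k -> ~ A n x.
  apply: contrapT => nk; apply: nodense; exists n, h, F => k E kh.
  apply: contrapT => nx; apply: nk; exists k, E; split=> // x xk Ax.
  by apply: nx; exists x.
pose le (p q : autQ * seq rat) := agree p.2 q.1 p.1 /\ {subset p.2 <= q.2}.
pose Q n (p : autQ * seq rat) := (forall x : autQ, agree p.2 x p.1 -> ~ A n x) /\
  forall q : rat, unpickle n = Some q -> q \in p.2 /\ aut_inv p.1 q \in p.2.
have [//|n [h F] _|w [_ wP]] := @fair_chain _ (fun=> True) le Q (aut1, [::]).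
  have [k [E [kh nA]]] := sparse n h F.
  pose D := if (unpickle n : option rat) is Some q then [:: q; aut_inv k q]
            else [::].
  exists (k, F ++ E ++ D); split=> //; split=> //=.
  - by move=> x xF; rewrite mem_cat xF.
  - move=> x xk; apply: nA; apply: agree_sub xk => z zE.
    by rewrite !mem_cat zE orbT.
  - by move=> q nq; rewrite /D nq !mem_cat !inE !eqxx !orbT.
have w_mono : forall i j, (i <= j)%N -> le (w i) (w j).
  apply: chain_trans => [p|p q r [pq pq'] [qr qr']|n]; last by case: (wP n).
    by split.
  split=> [|x /pq'/qr' //].
  exact: agree_trans (agree_sub pq' qr) pq.
pose S a b := exists2 n, a \in (w n).2 & (w n).1 a = b.
have Slate n a b : S a b -> exists2 i, (n <= i)%N & a \in (w i).2 /\ (w i).1 a = b.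
  move=> [j aj <-]; exists (maxn n j); first exact: leq_maxl.
  have [agr sub] := w_mono _ _ (leq_maxr n j).
  by rewrite agr ?sub.
have So : order_rel S.
  move=> a b a' b' [i ai iab] /(Slate i)[j ij [a'j ja'b']].
  have [agr sub] := w_mono _ _ ij.
  by rewrite -iab -ja'b' -agr ?aut_le.
have [a|b|g gS] := aut_of_rel So.
- have [_ _ [_ /(_ a (pickleK a))[aw _]]] := wP (pickle a).
  by exists ((w (pickle a).+1).1 a), (pickle a).+1.
- have [_ _ [_ /(_ b (pickleK b))[_ bw]]] := wP (pickle b).
  by exists (aut_inv (w (pickle b).+1).1 b), (pickle b).+1; rewrite ?autVK.
have [n Ang] := Acover g; have [_ _ [nA _]] := wP n.
by apply: (nA g) => // x xw; apply: gS; exists n.+1.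
Qed.

(** * Complete metric spaces *)

Section CompleteMetric.
Context (R : realType) (X : metricType R).
Hypothesis X_complete : forall F : set_system X,
  ProperFilter F -> cauchy F -> exists x : X, F --> x.

Lemma open_localP (U : set X) :
  open U <-> forall x, U x -> exists V, [/\ open V, V x & V `<=` U].
Proof.
rewrite {1}openE; split=> [UU x /UU|UU x /UU[V [oV Vx VU]]].
  by rewrite /interior nbhsE => -[V [oV Vx] VU]; exists V; split.
by apply: filterS VU _; apply: open_nbhs_nbhs; split.
Qed.

Lemma open_mdistP (U : set X) :
  open U <->
  forall x, U x -> exists2 e : R, 0 < e & forall y, mdist x y < e -> U y.
Proof.
rewrite openE; split=> UU x /UU.
  move=> /nbhs_ballP[e /= e0 eU]; exists e => // y xy.
  by apply: eU; rewrite ballEmdist.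
move=> [e e0 eU]; apply/nbhs_ballP; exists e => // y; rewrite ballEmdist.
exact: eU.
Qed.

Lemma open_mdist_lt (x : X) (e : R) : open [set y | mdist x y < e].
Proof.
apply/open_mdistP => y /= xy; exists (e - mdist x y); first by rewrite subr_gt0.
by move=> z yz; rewrite (le_lt_trans (metric_triangle x y z)) // -ltrBrDl.
Qed.

Lemma open_mdist_gt (x : X) (e : R) : open [set y | e < mdist x y].
Proof.
apply/open_mdistP => y /= xy; exists (mdist x y - e); first by rewrite subr_gt0.
move=> z yz; have := metric_triangle x z y; rewrite (metric_sym z y); lra.
Qed.

Lemma metric_separated (x y : X) : x <> y ->
  exists U V : set X, [/\ open U, open V, U x, V y & U `&` V = set0].
Proof.
move=> xy; have d0 : 0 < mdist x y by rewrite mdist_gt0; apply/eqP.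
exists [set z | mdist x z < mdist x y / 2], [set z | mdist x y / 2 < mdist x z].
split; [exact: open_mdist_lt|exact: open_mdist_gt| | |].
- by rewrite /= mdistxx divr_gt0.
- by rewrite /=; lra.
- by apply/seteqP; split=> // z [/= /lt_trans/[apply]]; rewrite ltxx.
Qed.

Lemma complete_limit (u : nat -> X) :
  (forall n, exists a, forall k, (n < k)%N -> mdist a (u k) <= n.+1%:R^-1) ->
  exists l, forall U : set X, open U -> U l ->
    exists N, forall k, (N <= k)%N -> U (u k).
Proof.
move=> small; have [|l ul] := @X_complete (u @ \oo) _.
  apply: cauchy_exP => e e0.
  have [n _ /(_ n (leqnn n)) ne] := near_infty_natSinv_lt (PosNum e0).
  have [a ua] := small n; exists a; exists n.+1 => // k /= nk.
  by rewrite ballEmdist /=; apply: le_lt_trans ne; apply: ua.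
exists l => U oU Ul.
have [|N _ NU] := ul U; first exact: open_nbhs_nbhs.
by exists N => k Nk; apply: NU.
Qed.

Lemma complete_limit_ball (u : nat -> X) (l a : X) (e : R) (n : nat) :
  (forall U : set X, open U -> U l ->
    exists N, forall k, (N <= k)%N -> U (u k)) ->
  (forall k, (n <= k)%N -> mdist a (u k) <= e) -> mdist a l <= e.
Proof.
move=> ul ue; rewrite leNgt; apply/negP => el.
have [N NU] := ul _ (open_mdist_gt a e) el.
have := NU _ (leq_maxl N n) => /=.
by rewrite ltNge ue ?leq_maxr.
Qed.

(** Baire's theorem relative to a closed subset [C]. *)
Lemma baire (C : set X) (U : nat -> set X) (V : set X) :
  closed C -> (forall n, open (U n)) ->
  (forall n W, open W -> W `&` C !=set0 -> W `&` C `&` U n !=set0) ->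
  open V -> V `&` C !=set0 ->
  exists x, [/\ V x, C x & forall n, U n x].
Proof.
move=> cC oU dU oV [x0 [Vx0 Cx0]].
pose cb (p : X * R) : set X := [set y | mdist p.1 y <= p.2].
have shrink W x n : open W -> W x ->
    exists e : R, [/\ 0 < e, e <= n.+1%:R^-1 & cb (x, e) `<=` W].
  move=> /open_mdistP/[apply] -[e e0 eW].
  exists (Num.min (e / 2) n.+1%:R^-1).
  rewrite lt_min divr_gt0 // invr_gt0 ltr0n; split=> //.
    by rewrite ge_min lexx orbT.
  move=> y; rewrite /cb /= le_min => /andP[xy _].
  by apply: eW; rewrite (le_lt_trans xy) // ltr_pdivrMr // ltr_pMr // ltr1n.
have [e0 [e00 _ e0V]] := shrink V x0 0%N oV Vx0.
pose P (p : X * R) := C p.1 /\ 0 < p.2.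
pose le (p q : X * R) := cb q `<=` cb p.
pose Q n (p : X * R) := p.2 <= n.+1%:R^-1 /\ cb p `<=` U n.
have [|n [x e] [/= Cx egt0]|w [w0 wP]] := @fair_chain _ P le Q (x0, e0) => //.
  have [|y [[xy Cy] Uy]] := dU n _ (open_mdist_lt x e).
    by exists x; rewrite /= mdistxx.
  have [||d [d0 dn dU']] := @shrink ([set y | mdist x y < e] `&` U n) y n.
  - by apply: openI => //; exact: open_mdist_lt.
  - by split.
  by exists (y, d); split=> //; [move=> z /dU'[/ltW]|split=> // z /dU'[]].
have w_mono : forall m n, (m <= n)%N -> le (w m) (w n).
  apply: chain_trans => [p x //|p q r pq qr x /qr/pq //|n]; by case: (wP n).
have cbw m n : (m <= n)%N -> cb (w m) (w n).1.
  move=> mn; apply: (w_mono m n mn); rewrite /cb /= mdistxx ltW //.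
  by have [[]] := wP n.
have [n|l wl] := @complete_limit (fun n => (w n).1).
  exists (w n.+1).1 => k nk; have [_ _ [le_n _]] := wP n.
  exact: le_trans (cbw n.+1 k nk) le_n.
have cbl n : cb (w n) l by apply: complete_limit_ball wl (cbw n).
exists l; split=> [||n].
- by apply: e0V; rewrite -w0; apply: cbl.
- apply: contrapT => nCl; have [|N NC] := wl (~` C) _ nCl.
    exact: closed_openC.
  by apply: (NC N) => //; have [[]] := wP N.
- by have [_ _ [_]] := wP n; apply; apply: cbl.
Qed.

Lemma second_countable_base : @second_countable X ->
  exists B : nat -> set X, (forall n, open (B n)) /\
    forall (U : set X) x, open U -> U x -> exists n, B n x /\ B n `<=` U.
Proof.
move=> [S /countable_injP[f finj] [So Snbhs]].
exists (fun n => \bigcup_(U in [set U | S U /\ f U = n]) U); split=> [n|U x oU Ux].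
  by apply: bigcup_open => V [/So].
have [|V [SV Vx] VU] := Snbhs x U; first exact: open_nbhs_nbhs.
exists (f V); split=> [|y [W [SW fWV] Wy]]; first by exists V.
by apply: VU; rewrite -(finj W V) ?inE.
Qed.

End CompleteMetric.

(** * Polish semigroup topologies on the increasing maps *)

Section PolishSemigroup.
Context (R : realType) (m : Metric R MQ).
Let T : metricType R := Metric.Pack m.
Hypothesis T_complete : forall F : set_system T,
  ProperFilter F -> cauchy F -> exists x : T, F --> x.
Hypothesis T_second_countable : @second_countable T.
Hypothesis T_semigroup : forall (f g : MQ) (W : set T),
  open W -> W (MQ_comp f g) -> exists U V : set T,
    [/\ open U, open V, U f, V g
      & forall f' g', U f' -> V g' -> W (MQ_comp f' g')].

Let open_compl (f : MQ) (W : set T) :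
  open W -> open ([set g | W (MQ_comp f g)] : set T).
Proof.
move=> oW; apply/open_localP => g /= Wfg.
have [U [V [_ oV Uf Vg UVW]]] := T_semigroup oW Wfg.
by exists V; split=> // g' Vg'; apply: UVW.
Qed.

Let open_compr (g : MQ) (W : set T) :
  open W -> open ([set f | W (MQ_comp f g)] : set T).
Proof.
move=> oW; apply/open_localP => f /= Wfg.
have [U [V [oU _ Uf Vg UVW]]] := T_semigroup oW Wfg.
by exists U; split=> // f' Uf'; apply: UVW.
Qed.

Let constants : set T := [set s | MQ_comp s (MQ_const 0) = s].

Let constantsP (s : MQ) : constants s -> s = MQ_const (s 0).
Proof. by move=> <-; apply: MQ_ext => x. Qed.

Let constants_const (y : rat) : constants (MQ_const y).
Proof. exact: MQ_ext. Qed.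

Let constants_closed : closed constants.
Proof.
rewrite -[constants]setCK closedC; apply/open_localP => s ns.
have [U [V [oU oV Us Vs UV0]]] := metric_separated (x := MQ_comp s (MQ_const 0) : T) ns.
exists ([set s' | U (MQ_comp s' (MQ_const 0))] `&` V); split=> //.
  by apply: openI => //; exact: open_compr.
move=> s' [/= Us' Vs'] cs'; rewrite cs' in Us'.
have : (U `&` V) s' by []. by rewrite UV0.
Qed.

(** The constant maps form a countable complete metric space, so one of them
is isolated; as the shifts act transitively on them, all of them are. *)
Lemma open_eval (x y : rat) : open ([set s | MQ_fun s x = y] : set T).
Proof.
have [V [oV [y0 Vy0]]] : exists V : set T, open V /\
    exists y0, V `&` constants = [set MQ_const y0].
  apply: contrapT => /forallNP noV.
  pose U n : set T := [set s | forall y : rat, unpickle n = Some y -> s <> MQ_const y].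
  have [n|n W oW [s [Ws cs]]|||s [_ cs sU]] :=
      @baire R T T_complete constants U setT constants_closed.
  - rewrite /U; case: (unpickle n : option rat) => [z|]; last first.
      by apply/open_localP => s _; exists setT; split=> //; exact: openT.
    apply/open_localP => s /= sz.
    have [A [B [oA oB As Bz AB0]]] := metric_separated (x := s) (sz z erefl).
    exists A; split=> // s' As' _ [<-] s'z.
    have : (A `&` B) s' by rewrite s'z in As' *.
    by rewrite AB0.
  - have [|nU] := pselect ((W `&` constants `&` U n) !=set0); first by [].
    exfalso; case nz : (unpickle n : option rat) => [z|]; last first.
      by apply: nU; exists s; split=> // z; rewrite nz.
    have only t : W t -> constants t -> t = MQ_const z.
      move=> Wt ct; apply: contrapT => tz; apply: nU; exists t; split=> // z'.
      by rewrite nz => -[<-].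
    apply: (noV W); split=> //; exists z; apply/seteqP; split=> t.
      by move=> [Wt ct]; apply: only.
    by move=> ->; rewrite -(only s).
  - exact: openT.
  - by exists (MQ_const 0); split=> //; exact: constants_const.
  - exact: (sU (pickle (MQ_fun s 0)) (MQ_fun s 0) (pickleK _) (constantsP cs)).
(* [s] maps [x] to [y] iff the shift by [y0 - y] turns [s \o MQ_const x] into
   the isolated point [MQ_const y0]. *)
have -> : [set s | MQ_fun s x = y] = [set s | V (MQ_comp (MQ_shift (y0 - y))
    (MQ_comp s (MQ_const x)))].
  apply/seteqP; split=> s /=.
    move=> sx; have -> : MQ_comp (MQ_shift (y0 - y))
        (MQ_comp s (MQ_const x)) = MQ_const y0.
      by apply: MQ_ext => z; rewrite !MQ_compE !mkMQE sx addrC subrK.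
    by have [] : (V `&` constants) (MQ_const y0) by rewrite Vy0.
  move=> Vs; have : (V `&` constants) (MQ_comp (MQ_shift (y0 - y))
    (MQ_comp s (MQ_const x))) by split=> //; apply: MQ_ext.
  rewrite Vy0 => /(congr1 (fun t : MQ => t 0)); rewrite !MQ_compE !mkMQE; lra.
exact: (open_compr (MQ_const x) (open_compl (MQ_shift (y0 - y)) oV)).
Qed.

Lemma open_agree (f : MQ) (F : seq rat) : open ([set g | agree F g f] : set T).
Proof.
elim: F => [|x F ih].
  by apply/open_localP => g _; exists setT; split=> //; exact: openT.
have -> : [set g | agree (x :: F) g f] =
    [set g | MQ_fun g x = f x] `&` [set g | agree F g f].
  apply/seteqP; split=> g /=.
    by move=> gf; split=> [|y yF]; apply: gf; rewrite inE ?eqxx // yF orbT.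
  by move=> [gx gf] y; rewrite inE => /predU1P[->|/gf].
by apply: openI => //; exact: open_eval.
Qed.


Let countable_collision (n : R -> nat) :
  exists r s, [/\ r < s, s <= 1 & n r = n s].
Proof.
apply: contrapT => /forallNP inj.
have : countable (`[0, 1]%classic : set R).
  apply/countable_injP; exists n => r s; rewrite !inE /= !in_itv /=.
  move=> /andP[_ r1] /andP[_ s1] nrs.
  have [rs|sr|//] := ltgtP r s.
    by case: (inj r); exists s.
  by case: (inj s); exists r.
move/countable_lebesgue_measure0; rewrite lebesgue_measure_itv /= lte_fin ltr01.
by rewrite sube0 => /eqP; rewrite onee_eq0.
Qed.

(** Uncountably many indices meet countably many basic open sets: some [g s]
is so close to [g r] that it cannot be distinguished from it by [f r] and
[V]. *)
Let condensation (f g : R -> MQ) (V : set T) : open V ->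
  (forall r, r <= 1 -> V (MQ_comp (f r) (g r))) ->
  exists r s, [/\ r < s, s <= 1 & V (MQ_comp (f r) (g s))].
Proof.
move=> oV Vfg; have [B [_ BP]] := second_countable_base T_second_countable.
have /choice[n nP] (r : R) : exists n, r <= 1 ->
    B n (g r) /\ forall h : MQ, B n h -> V (MQ_comp (f r) h).
  have [r1|nr1] := pselect (r <= 1); last by exists 0%N.
  by have [n [Bn nV]] := BP _ _ (open_compl (f r) oV) (Vfg r r1); exists n.
have [r [s [rs s1 nrs]]] := countable_collision n.
exists r, s; split=> //; have [_] := nP r (le_trans (ltW rs) s1); apply.
by rewrite nrs; case: (nP s s1).
Qed.

Let hit_left (t : MQ) (V : set T) (L : set rat) (y : rat) :
  open V -> V t -> L !=set0 -> (forall x y, L y -> x <= y -> L x) ->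
  (forall x, L x -> exists2 y, L y & x < y) ->
  (forall x, L x -> t x <= y) -> (forall x, ~ L x -> y <= t x) ->
  exists2 t' : MQ, V t' & exists2 x, L x & t' x = y.
Proof.
move=> oV Vt L0 Ldown Lnomax tL tU.
have [f [g [fgt fgy]]] := fill_left R L0 Ldown Lnomax tL tU.
have [r r1|r [s [rs s1 Vrs]]] := @condensation f g V oV; first by rewrite fgt.
by exists (MQ_comp (f r) (g s)) => //; apply: fgy.
Qed.

Let hit_right (t : MQ) (V : set T) (U : set rat) (y : rat) :
  open V -> V t -> U !=set0 -> (forall x y, U x -> x <= y -> U y) ->
  (forall x, U x -> exists2 y, U y & y < x) ->
  (forall x, U x -> y <= t x) -> (forall x, ~ U x -> t x <= y) ->
  exists2 t' : MQ, V t' & exists2 x, U x & t' x = y.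
Proof.
move=> oV Vt U0 Uup Unomin tU tL.
have [f [g [fgt fgy]]] := fill_right R U0 Uup Unomin tU tL.
have [r r1|r [s [rs s1 Vrs]]] := @condensation f g V oV; first by rewrite fgt.
by exists (MQ_comp (f r) (g s)) => //; apply: fgy.
Qed.

Let hit_value (t : MQ) (V : set T) (q : rat) : open V -> V t ->
  exists2 t' : MQ, V t' & exists x, t' x = q.
Proof.
move=> oV Vt; have [tq|ntq] := pselect (exists x, t x = q); first by exists t.
(* One can insert the value [q] just below or just above the cut of the domain
   at which [t] jumps over [q]: a cut is either not attained from the left or
   not attained from the right. *)
pose L : set rat := [set x | t x < q].
have nL x : ~ L x -> q < t x.
  move=> /negP; rewrite -leNgt le_eqVlt => /predU1P[qt|//].
  by case: ntq; exists x.
have [[L0 Lnomax]|nLL] := pselect (L !=set0 /\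
    (forall x, L x -> exists2 y, L y & x < y)).
  have [|x Lx|x /nL/ltW //|t' Vt' [x _ t'x]] := @hit_left t V L q oV Vt L0 _ Lnomax.
  - by move=> x y Ly xy; apply: le_lt_trans Ly; exact: MQ_mono.
  - exact: ltW.
  - by exists t' => //; exists x.
have below x z : ~ L x -> L z -> z < x.
  by move=> nLx Lz; rewrite ltNge; apply/negP => /(MQ_mono t)/le_lt_trans/(_ Lz).
have [||x nLx|x nLx|x nnLx|t' Vt' [x _ t'x]] := @hit_right t V (~` L) q oV Vt.
- have [[x Lx]|nL0] := pselect (L !=set0); last first.
    by exists 0 => L0; apply: nL0; exists 0.
  apply: contrapT => nU; apply: nLL; split; first by exists x.
  move=> z Lz; exists (z + 1); last by rewrite ltrDl.
  by apply: contrapT => nLz; apply: nU; exists (z + 1).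
- move=> x z nLx xz Lz; apply: nLx; apply: le_lt_trans Lz; exact: MQ_mono.
- apply: contrapT => xmin; apply: nLL; split.
    exists (x - 1); apply: contrapT => nL1; apply: xmin.
    by exists (x - 1) => //; lra.
  move=> z Lz; have zx := below _ _ nLx Lz.
  have [zm mx] := midf_lt zx; exists ((z + x) / 2) => //.
  by apply: contrapT => nLm; apply: xmin; exists ((z + x) / 2).
- exact/ltW/nL.
- by apply: ltW; apply: contrapT.
- by exists t' => //; exists x.
Qed.

(** The generic maps are dense: otherwise some nonempty open set would miss
one of the countably many requirements that make a map generic, which
[condensation] forbids. *)
Lemma generic_dense (V : set T) : open V -> V !=set0 ->
  exists2 d : MQ, V d & generic d.
Proof.
move=> oV V0.
pose U n : set T := [set s : MQ | forall q : rat, unpickle n = Some q ->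
  [/\ exists x, s x = q, exists2 x, q < x & s x = s q
    & exists2 x, x < q & s x = s q]].
have [n|n W oW [t [Wt _]]|||s [Vs _ sU]] := @baire R T T_complete setT U V closedT.
- apply/open_localP => s sU; case nq : (unpickle n : option rat) => [q|]; last first.
    by exists setT; split=> // [|s' _ q]; [exact: openT|rewrite nq].
  have [[x sx] [y qy sy] [z zq sz]] := sU q nq.
  exists [set s' | agree [:: x; y; z; q] s' s]; split=> //; first exact: open_agree.
  move=> s' s's q'; rewrite nq => -[<-].
  have [sx' sy' sz' sq'] : [/\ MQ_fun s' x = MQ_fun s x,
      MQ_fun s' y = MQ_fun s y, MQ_fun s' z = MQ_fun s z & MQ_fun s' q = MQ_fun s q].
    by split; apply: s's; rewrite !inE eqxx ?orbT.
  split; [by exists x; rewrite sx'|by exists y; rewrite // sy' sq'|].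
  by exists z; rewrite // sz' sq'.
- case nq : (unpickle n : option rat) => [q|]; last first.
    by exists t; split=> // q; rewrite nq.
  (* Three successive corrections inside [W], each of them freezing the
     values that the previous ones have achieved. *)
  have [t1 Wt1 [x t1x]] := @hit_value t W q oW Wt.
  have oW1 := openI oW (open_agree t1 [:: x; q]).
  have [||z qz|z qz|z /negP|t2 [Wt2 t21] [y qy t2y]] :=
      @hit_right t1 _ [set z | q < z] (t1 q) oW1 (conj Wt1 (agree_refl _)).
  + by exists (q + 1); rewrite /= ltrDl.
  + by move=> z z' /= qz; apply: lt_le_trans.
  + by have [qm mz] := midf_lt qz; exists ((q + z) / 2).
  + by rewrite MQ_mono ?ltW.
  + by rewrite -leNgt => zq; rewrite MQ_mono.
  have oW2 := openI oW (open_agree t2 [:: x; q; y]).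
  have [||z zq|z zq|z /negP|t3 [Wt3 t32] [u uq t3u]] :=
      @hit_left t2 _ [set z | z < q] (t2 q) oW2 (conj Wt2 (agree_refl _)).
  + by exists (q - 1); rewrite /= ltrBlDr ltrDl.
  + by move=> z z' /= zq zz'; apply: le_lt_trans zq.
  + by have [zm mq] := midf_lt zq; exists ((z + q) / 2).
  + by rewrite MQ_mono ?ltW.
  + by rewrite -leNgt => qz; rewrite MQ_mono.
  exists t3; split=> // q'; rewrite nq => -[<-].
  have [t3x t3q t3y] : [/\ t3 x = t2 x, t3 q = t2 q & t3 y = t2 y].
    by split; apply: t32; rewrite !inE eqxx ?orbT.
  have [t2x t2q] : t2 x = t1 x /\ t2 q = t1 q.
    by split; apply: t21; rewrite !inE eqxx ?orbT.
  split; [exists x|exists y|exists u] => //.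
  + by rewrite t3x t2x.
  + by rewrite t3y t3q t2y t2q.
  + by rewrite t3u t3q.
- exact: oV.
- by have [x Vx] := V0; exists x.
- by exists s => // q; apply: (sU (pickle q)); rewrite pickleK.
Qed.

(** Openness for the group topology induced by [m], in which both a map and
its inverse must stay close. *)
Let open_aut (X : set autQ) : Prop := forall x, X x ->
  exists A B : set MQ, [/\ open (A : set T), open (B : set T), A x, B (aut_inv x)
    & forall y : autQ, A y -> B (aut_inv y) -> X y].

Let open_autI (X Y : set autQ) : open_aut X -> open_aut Y -> open_aut (X `&` Y).
Proof.
move=> oX oY x [/oX[A [B [oA oB Ax Bx ABX]]] /oY[A' [B' [oA' oB' Ax' Bx' ABY]]]].
exists (A `&` A'), (B `&` B'); split; [exact: openI|exact: openI|by []|by []|].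
by move=> y [Ay A'y] [By B'y]; split; [apply: ABX|apply: ABY].
Qed.

Let open_aut_map (g : MQ) (A : set T) :
  open A -> open_aut [set x : autQ | A (MQ_comp x g)].
Proof.
move=> oA x Ax; exists [set s | A (MQ_comp s g)], setT.
by split=> //; [exact: open_compr|exact: openT].
Qed.

Let open_aut_inv (A : set T) : open A -> open_aut [set x : autQ | A (aut_inv x)].
Proof. by move=> oA x Ax; exists setT, A; split=> //; exact: openT. Qed.

Let open_aut_agree (f : MQ) (F : seq rat) : open_aut [set x : autQ | agree F x f].
Proof.
move=> x xf; exists [set s | agree F s f], setT.
by split=> //; [exact: open_agree|exact: openT].
Qed.

(** Countably many left translates of [X] cover the group, so [X] cannot be
nowhere dense. *)
Let somewhere_dense (X : set autQ) (x0 : autQ) :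
  open_aut X -> X x0 -> exists h F, dense_at X h F.
Proof.
move=> oX Xx0; have [A [B [oA oB Ax0 Bx0 ABX]]] := oX x0 Xx0.
have [Bs [_ BsP]] := second_countable_base T_second_countable.
pose part (ij : nat * nat) : set autQ := [set z : autQ |
  [/\ Bs ij.1 (aut_map z), Bs ij.2 (aut_inv z)
  & exists c : autQ, (forall s, Bs ij.1 s -> A (MQ_comp c s)) /\
                     forall s, Bs ij.2 s -> B (MQ_comp s (aut_inv c))]].
have [z|n [h [F hF]]] :=
    @baire_aut (fun n => if unpickle n is Some ij then part ij else set0).
  pose c := autM x0 (autV z).
  have cz : MQ_comp c z = x0 by apply: MQ_ext => q; rewrite !MQ_compE autK.
  have zc : MQ_comp (aut_inv z) (aut_inv c) = aut_inv x0.
    by apply: MQ_ext => q; rewrite !MQ_compE autK.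
  have [|i [Bz BA]] := BsP _ (z : MQ) (open_compl c oA); first by rewrite /= cz.
  have [|j [Bz' BB]] := BsP _ (aut_inv z) (open_compr (aut_inv c) oB).
    by rewrite /= zc.
  by exists (pickle (i, j)); rewrite pickleK; split=> //; exists c.
case: (unpickle n) hF => [ij|] hF; last by have [] := hF h [::] (agree_refl _).
have [_ _ [_ _ [c [cA cB]]]] := hF h [::] (agree_refl _).
exists (autM c h), F => k E kch.
have [|x xk [Bx Bx' _]] := hF (autM (autV c) k) E.
  by move=> q qF; rewrite MQ_compE kch // MQ_compE autK.
exists (autM c x); first by move=> q qE; rewrite MQ_compE xk // MQ_compE autVK.
by apply: ABX; [exact: cA|exact: cB].
Qed.

Let refine (X : set autQ) (h : autQ) (F : seq rat) (f : autQ -> MQ) (e : R) :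
  (forall A : set T, open A -> open_aut [set x : autQ | A (f x)]) -> 0 < e ->
  open_aut X -> dense_at X h F ->
  exists Y k E, [/\ [/\ open_aut Y, Y `<=` X & dense_at Y k E],
    agree F k h, {subset F <= E}
    & exists a : T, forall y, Y y -> mdist a (f y : T) <= e].
Proof.
move=> of_ e0 oX hF; have [x xh Xx] := hF h F (agree_refl _).
pose Y := X `&` [set y : autQ | agree F y x] `&`
  [set y : autQ | mdist (f x : T) (f y : T) < e].
have oY : open_aut Y.
  apply: open_autI; first by apply: open_autI => //; exact: open_aut_agree.
  exact: of_ _ (open_mdist_lt _ _).
have [|k [E kE]] := somewhere_dense (x0 := x) oY.
  by split; [split=> //; exact: agree_refl|rewrite /= mdistxx].
have kx : agree F k x by apply: dense_at_agree kE _ => y [[_ ?] _].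
exists Y, k, (F ++ E); split.
- split=> //; first by move=> y [[]].
  by apply: dense_at_sub kE => // q qE; rewrite mem_cat qE orbT.
- exact: agree_trans kx xh.
- by move=> q qF; rewrite mem_cat qF.
- by exists (f x) => y [_] /ltW.
Qed.

(** On the automorphism group, the topology induced by [m] is the pointwise
one: the open mapping theorem for Polish groups. A neighbourhood of the identity
is pointwise dense around some [h]. If [g] fixes enough points, then [h \o g] is
as good as [h], and shrinking this neighbourhood in two ways at once gives [x n]
and [y n] with a common pointwise limit, such that the inverses of the [x n]
converge for [m] to some [b] and the maps [y n \o g] to some [c], both [b] and
[c] close to the identity. So [g = b \o c] is close to the identity, too. *)
Lemma aut_open_mapping (W : set T) : open W -> W MQ_id ->
  exists F : seq rat, forall g : autQ, agree F g MQ_id -> W (g : MQ).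
Proof.
move=> oW W1; have W11 : W (MQ_comp MQ_id MQ_id).
  by rewrite (_ : MQ_comp _ _ = MQ_id) //; apply: MQ_ext.
have [U [V [oU oV U1 V1 UVW]]] := T_semigroup oW W11.
have [e e0 eUV] : exists2 e : R, 0 < e &
    forall s, mdist (MQ_id : T) s <= e -> U s /\ V s.
  have [|d d0 dUV] := (open_mdistP (U `&` V)).1 (openI oU oV) MQ_id; first by [].
  exists (d / 2); first by rewrite divr_gt0.
  move=> s sd; apply: dUV; apply: le_lt_trans sd _.
  by rewrite ltr_pdivrMr // ltr_pMr // ltr1n.
pose N : set T := [set s | mdist (MQ_id : T) s < e].
have oN : open N by exact: open_mdist_lt.
have comp1 (f : MQ) : MQ_comp f MQ_id = f by exact: MQ_ext.
pose X0 : set autQ := [set x : autQ | N (MQ_comp x MQ_id)] `&`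
  [set x : autQ | N (aut_inv x)].
have oX0 : open_aut X0.
  by apply: open_autI; [exact: open_aut_map|exact: open_aut_inv].
have [|h0 [F0 h0F0]] := somewhere_dense (x0 := aut1) oX0.
  by split; rewrite /= ?comp1 /N /= mdistxx.
exists F0 => g gF0.
pose Y0 : set autQ := [set y : autQ | N (MQ_comp y g)].
have oY0 : open_aut Y0 by exact: open_aut_map.
(* As [g] fixes [F0], translating by [g] preserves the open set of [h0], [F0]. *)
have h0Y0 : dense_at Y0 h0 F0.
  move=> k E kh0.
  have [|x xk [Nx _]] := h0F0 (autM k g) [seq aut_inv g q | q <- E].
    by move=> q qF; rewrite MQ_compE gF0 // kh0.
  exists (autM x (autV g)).
    by move=> q qE; rewrite MQ_compE xk ?map_f // MQ_compE autVK.
  rewrite /Y0 /= (_ : MQ_comp _ _ = MQ_comp x MQ_id) //.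
  by apply: MQ_ext => q; rewrite !MQ_compE autK.
pose state := (set autQ * set autQ * autQ * seq rat)%type.
pose P (p : state) := let: (X, Y, h, F) := p in
  [/\ open_aut X, open_aut Y, dense_at X h F & dense_at Y h F].
pose le (p q : state) := let: (X, Y, h, F) := p in let: (X', Y', h', F') := q in
  [/\ X' `<=` X, Y' `<=` Y, agree F h' h & {subset F <= F'}].
pose Q n (p : state) := let: (X, Y, h, F) := p in
  [/\ exists a : T, forall x, X x -> mdist a (aut_inv x : T) <= n.+1%:R^-1,
      exists a : T, forall y, Y y -> mdist a (MQ_comp y g : T) <= n.+1%:R^-1
    & forall q : rat, unpickle n = Some q -> q \in F].
have [//|n [[[X Y] h] F] [oX oY Xh Yh]|w [w0 wP]] :=
    @fair_chain state P le Q (X0, Y0, h0, F0).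
  have e1 : 0 < (n.+1%:R^-1 : R) by rewrite invr_gt0 ltr0n.
  have [X1 [h1 [F1 [[oX1 X1X X1h1] h1h FF1 X1small]]]] :=
    refine (f := aut_inv) open_aut_inv e1 oX Xh.
  have [Y2 [h2 [F2 [[oY2 Y2Y Y2h2] h2h1 F1F2 Y2small]]]] :=
    refine (f := fun y : autQ => MQ_comp y g) (@open_aut_map g) e1 oY
      (dense_at_sub h1h FF1 Yh).
  pose D := if (unpickle n : option rat) is Some q then [:: q] else [::].
  have sub2 : {subset F2 <= F2 ++ D} by move=> q qF; rewrite mem_cat qF.
  exists (X1, Y2, h2, F2 ++ D); split.
  - split=> //; last exact: dense_at_sub (agree_refl _) sub2 Y2h2.
    by apply: dense_at_sub X1h1 => // q /F1F2/sub2.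
  - split=> //; first exact: agree_trans (agree_sub FF1 h2h1) h1h.
    by move=> q /FF1/F1F2/sub2.
  - by split=> // q nq; rewrite /D nq mem_cat mem_head orbT.
have w_mono : forall i j, (i <= j)%N -> le (w i) (w j).
  apply: chain_trans => [[[[X Y] h] F]|[[[X Y] h] F] [[[X' Y'] h'] F']
      [[[X'' Y''] h''] F'']|n]; last by case: (wP n).
    by split.
  move=> [X'X Y'Y h'h FF'] [X''X' Y''Y' h''h' F'F'']; split.
  - exact: subset_trans X''X' X'X.
  - exact: subset_trans Y''Y' Y'Y.
  - exact: agree_trans (agree_sub FF' h''h') h'h.
  - by move=> q /FF'/F'F''.
have /choice[x xP] n : exists x : autQ, agree (w n).2 x (w n).1.2 /\ (w n).1.1.1 x.
  have [Pn _ _] := wP n; case: (w n) Pn => [[[X Y] h] F] /= [_ _ Xh _].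
  by have [x] := Xh h F (agree_refl _); exists x.
have /choice[y yP] n : exists y : autQ, agree (w n).2 y (w n).1.2 /\ (w n).1.1.2 y.
  have [Pn _ _] := wP n; case: (w n) Pn => [[[X Y] h] F] /= [_ _ _ Yh].
  by have [y] := Yh h F (agree_refl _); exists y.
have lew i j : (i <= j)%N -> [/\ (w j).1.1.1 `<=` (w i).1.1.1,
    (w j).1.1.2 `<=` (w i).1.1.2, agree (w i).2 (w j).1.2 (w i).1.2
    & {subset (w i).2 <= (w j).2}].
  by move/w_mono; case: (w i) => [[[X Y] h] F]; case: (w j) => [[[X' Y'] h'] F'].
have Qw n : [/\ exists a : T, forall z, (w n.+1).1.1.1 z ->
      mdist a (aut_inv z : T) <= n.+1%:R^-1,
    exists a : T, forall z, (w n.+1).1.1.2 z ->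
      mdist a (MQ_comp z g : T) <= n.+1%:R^-1
    & forall q : rat, unpickle n = Some q -> q \in (w n.+1).2].
  by have [_ _] := wP n; case: (w n.+1) => [[[X Y] h] F].
have [n|b xb] := complete_limit T_complete (u := fun n => aut_inv (x n) : T).
  have [[a ax] _ _] := Qw n; exists a => k nk; apply: ax.
  by have [sub _ _ _] := lew _ _ nk; apply: sub; case: (xP k).
have [n|c yc] := complete_limit T_complete (u := fun n => MQ_comp (y n) g : T).
  have [_ [a ay] _] := Qw n; exists a => k nk; apply: ay.
  by have [_ sub _ _] := lew _ _ nk; apply: sub; case: (yP k).
have [Ub _] : U b /\ V b.
  apply: eUV; apply: (complete_limit_ball (n := 0%N) xb) => k k0; apply: ltW.
  have [sub _ _ _] := lew 0%N k k0; have [_ /sub] := xP k.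
  by rewrite w0 => -[].
have [_ Vc] : U c /\ V c.
  apply: eUV; apply: (complete_limit_ball (n := 0%N) yc) => k k0; apply: ltW.
  have [_ sub _ _] := lew 0%N k k0; have [_ /sub] := yP k.
  by rewrite w0.
have -> : (g : MQ) = MQ_comp b c; last exact: UVW.
apply: MQ_ext => q; rewrite MQ_compE.
pose i := (pickle (g q)).+1; pose v := (w i).1.2 (g q).
have [_ _ /(_ _ (pickleK _)) gqw] := Qw (pickle (g q)).
have [N1 xN1] := xb _ (open_eval v (MQ_fun b v)) erefl.
have [N2 yN2] := yc _ (open_eval q (MQ_fun c q)) erefl.
have late k : (i <= k)%N -> x k (g q) = v /\ y k (g q) = v.
  move=> ik; have [_ _ agr sub] := lew _ _ ik.
  have [xk _] := xP k; have [yk _] := yP k.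
  by rewrite xk ?sub // yk ?sub // agr.
pose k := maxn i (maxn N1 N2).
have [xk yk] := late k (leq_maxl _ _).
have := yN2 k (leq_trans (leq_maxr N1 N2) (leq_maxr i _)).
rewrite /= MQ_compE yk => <-.
have := xN1 k (leq_trans (leq_maxl N1 N2) (leq_maxr i _)).
by rewrite /= -{1}xk autK.
Qed.

(** Two generic maps [d] and [d'] close to [f] pointwise differ by an
automorphism fixing many points, which the previous lemma makes negligible:
so [d'] is close to [f] whenever [d] is. As the generic maps are dense, this
extends to all maps up to closure, and metric spaces are regular. *)
Lemma open_pointwise (W : set T) (f : MQ) : open W -> W f ->
  exists F, [set g | agree F g f] `<=` W.
Proof.
move=> oW Wf; have [e e0 eW] := (open_mdistP W).1 oW f Wf.
pose V : set T := [set s | mdist (f : T) s < e / 2].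
have oV : open V by exact: open_mdist_lt.
have [|A [B [oA oB Af B1 ABV]]] := @T_semigroup f MQ_id V oV.
  by rewrite (_ : MQ_comp _ _ = f) /V /= ?mdistxx ?divr_gt0 //; exact: MQ_ext.
have [F FB] := aut_open_mapping oB B1.
exists F => f' f'f; apply: contrapT => nWf'.
have far : e / 2 < mdist (f : T) f'.
  rewrite ltNge; apply/negP => close; apply: nWf'; apply: eW.
  by apply: le_lt_trans close _; rewrite ltr_pdivrMr // ltr_pMr // ltr1n.
have [||d' [d'far d'f] dg'] := @generic_dense
    ([set s | e / 2 < mdist (f : T) s] `&` [set s | agree F s f]).
- by apply: openI; [exact: open_mdist_gt|exact: open_agree].
- by exists f'.
have [||d [Ad df] dg] := @generic_dense (A `&` [set s | agree F s f]).
- by apply: openI => //; exact: open_agree.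
- by exists f.
have [c cF d'E] := generic_transitive dg dg' (agree_trans df (agree_sym d'f)).
have : V d' by rewrite d'E; apply: ABV => //; apply: FB.
by rewrite /V /= ltNge (ltW d'far).
Qed.

Lemma polish_semigroup_pointwise :
  same_topology (Topological.class T) pointwise_topology.
Proof.
apply/seteqP; split=> U oU.
  by apply/pointwise_openP => f Uf; exact: open_pointwise.
apply/open_localP => f /((pointwise_openP U).1 oU)[F FU].
by exists [set g | agree F g f]; split=> //; exact: open_agree.
Qed.

End PolishSemigroup.

Theorem theorem1 (R : realType) :
  (polish R pointwise_topology /\
   semigroup_topology MQ_comp pointwise_topology) /\
  (forall tau : Topological MQ,
     polish R tau -> semigroup_topology MQ_comp tau ->
     same_topology tau pointwise_topology).
Proof.
split.
  split; last exact: pointwise_semigroup.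
  split; first exact: pointwise_second_countable.
  exact: pointwise_completely_metrizable.
move=> tau [tau_sc [m m_tau m_complete]] tau_sg.
suff: same_topology (Topological.class (Metric.Pack m)) pointwise_topology.
  by rewrite /same_topology -m_tau.
have oE (U : set MQ) : @open (Metric.Pack m) U = @open (Topological.Pack tau) U.
  exact: (congr1 (fun O : set (set MQ) => O U) m_tau).
apply: polish_semigroup_pointwise => //.
- have [S cS [So Snbhs]] := tau_sc; exists S => //; split=> [U /So|f W].
    by rewrite oE.
  rewrite nbhsE => -[U [oU Uf] UW]; have := Snbhs f W; apply.
  by rewrite nbhsE; exists U => //; split=> //; rewrite -oE.
- move=> f g W; rewrite oE => oW Wfg.
  have [|[U V] /= [nU nV] UVW] := tau_sg (f, g) W; first exact: open_nbhs_nbhs.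
  exists (@interior (Topological.Pack tau) U), (@interior (Topological.Pack tau) V).
  rewrite !oE; split; [exact: open_interior|exact: open_interior|exact: nU|exact: nV|].
  move=> f' g' /interior_subset Uf' /interior_subset Vg'.
  exact: (UVW (f', g')).
Qed.
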